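(* Let $(\mathscr{K},\otimes,1)$ be a tensor triangulated category. (a) For any object $a\in\mathscr{K}$, the open subset $U(a)=\operatorname{Spc}(\mathscr{K})\smallsetminus\operatorname{supp}(a)$ is quasi-compact. (b) Any quasi-compact open subset of $\operatorname{Spc}(\mathscr{K})$ is of the form $U(a)$ for some $a\in\mathscr{K}$.
   Context: All categories are essentially small. A tensor triangulated category $(\mathscr{K},\otimes,1)$ is a triangulated category $\mathscr{K}$ (translation functor $T$) with a symmetric monoidal product $\otimes:\mathscr{K}\times\mathscr{K}\to\mathscr{K}$ which is exact in each variable, with unit $1$. A thick $\otimes$-ideal of $\mathscr{K}$ is a full subcategory $\mathscr{A}$ containing $0$ such that: (a) for any distinguished triangle $a\to b\to c\to Ta$, if two of $a,b,c$ belong to $\mathscr{A}$ then so does the third; (b) if $a\in\mathscr{A}$ and $a\simeq b\oplus c$ in $\mathscr{K}$ then $b,c\in\mathscr{A}$; (c) if $a\in\mathscr{A}$ and $b\in\mathscr{K}$ then $a\otimes b\in\mathscr{A}$. A prime of $\mathscr{K}$ is a thick $\otimes$-ideal $\mathscr{P}\subsetneq\mathscr{K}$ such that $a\otimes b\in\mathscr{P}$ implies $a\in\mathscr{P}$ or $b\in\mathscr{P}$. $\operatorname{Spc}(\mathscr{K})$ is the set of all primes of $\mathscr{K}$, with the Zariski topology, whose closed subsets are the sets $Z(\mathscr{S})=\{\mathscr{P}\in\operatorname{Spc}(\mathscr{K})\mid\mathscr{S}\cap\mathscr{P}=\varnothing\}$ for collections of objects $\mathscr{S}\subset\mathscr{K}$.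 For an object $a$, $\operatorname{supp}(a)=Z(\{a\})=\{\mathscr{P}\mid a\notin\mathscr{P}\}$ and $U(a)=\{\mathscr{P}\mid a\in\mathscr{P}\}$. *)

(* Defs.v *)
From HB Require Import structures.
From mathcomp Require Import all_boot all_order all_algebra.
From mathcomp Require Import boolp classical_sets topology.

Set Implicit Arguments.
Unset Strict Implicit.
Unset Printing Implicit Defensive.

Import GRing.Theory.
Local Open Scope classical_set_scope.
Local Open Scope ring_scope.

Declare Scope ttcat_scope.
Delimit Scope ttcat_scope with tt.
Local Open Scope ttcat_scope.

Reserved Notation "g ∘ f" (at level 40, left associativity).
Reserved Notation "a ⊕ b" (at level 50, left associativity).
Reserved Notation "a ⊗ b" (at level 40, left associativity).
Reserved Notation "f ⊗₁ g" (at level 40, left associativity).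

(* Objects form a type, so full subcategories (predicates on objects), and hence
   primes, again form a type: this is the role played by essential smallness.
   The choice structure contained in [zmodType] is no restriction classically. *)
Record preaddCat := PreaddCat {
  ob :> Type;
  hom : ob -> ob -> zmodType;
  idm : forall a, hom a a;
  comp : forall a b c, hom b c -> hom a b -> hom a c;
  compA : forall a b c d (h : hom c d) (g : hom b c) (f : hom a b),
    comp h (comp g f) = comp (comp h g) f;
  comp1m : forall a b (f : hom a b), comp (idm b) f = f;
  compm1 : forall a b (f : hom a b), comp f (idm a) = f;
  compDl : forall a b c (g g' : hom b c) (f : hom a b),
    comp (g + g') f = comp g f + comp g' f;
  compDr : forall a b c (g : hom b c) (f f' : hom a b),
    comp g (f + f') = comp g f + comp g f'
}.
Arguments idm {C} a : rename.
Notation "g ∘ f" := (comp g f) : ttcat_scope.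

Definition is_iso (C : preaddCat) (a b : C) (f : hom a b) : Prop :=
  exists g : hom b a, g ∘ f = idm a /\ f ∘ g = idm b.

Definition isomorphic (C : preaddCat) (a b : C) : Prop :=
  exists f : hom a b, is_iso f.

Record functor (C D : preaddCat) := Functor {
  fob :> C -> D;
  fmap : forall a b, hom a b -> hom (fob a) (fob b);
  fmap1 : forall a, fmap (idm a) = idm (fob a);
  fmapM : forall a b c (g : hom b c) (f : hom a b),
    fmap (g ∘ f) = fmap g ∘ fmap f
}.
Arguments fmap {C D} F {a b} _ : rename.

Definition idF (C : preaddCat) : functor C C :=
  @Functor C C id (fun _ _ f => f) (fun _ => erefl) (fun _ _ _ _ _ => erefl).

Program Definition compF (C D E : preaddCat) (G : functor D E) (F : functor C D)
    : functor C E :=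
  @Functor C E (fun a => G (F a)) (fun _ _ f => fmap G (fmap F f)) _ _.
Next Obligation. by move=> * /=; rewrite !fmap1. Qed.
Next Obligation. by move=> * /=; rewrite !fmapM. Qed.

Definition additiveF (C D : preaddCat) (F : functor C D) : Prop :=
  forall (a b : C) (f g : hom a b), fmap F (f + g) = fmap F f + fmap F g.

Definition is_nat_iso (C D : preaddCat) (F G : functor C D)
    (th : forall a, hom (F a) (G a)) : Prop :=
  (forall a, is_iso (th a)) /\
  (forall a b (f : hom a b), th b ∘ fmap F f = fmap G f ∘ th a).

Definition is_equivalence (C D : preaddCat) (F : functor C D) : Prop :=
  exists G : functor D C,
    (exists eta, @is_nat_iso C C (idF C) (compF G F) eta) /\
    (exists eps, @is_nat_iso D D (compF F G) (idF D) eps).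

Record addCat := AddCat {
  addCat_base :> preaddCat;
  zero_ob : addCat_base;
  zero_obP : idm zero_ob = 0;
  dsum : addCat_base -> addCat_base -> addCat_base;
  dinl : forall a b, hom a (dsum a b);
  dinr : forall a b, hom b (dsum a b);
  dprl : forall a b, hom (dsum a b) a;
  dprr : forall a b, hom (dsum a b) b;
  dprl_inl : forall a b, dprl a b ∘ dinl a b = idm a;
  dprr_inr : forall a b, dprr a b ∘ dinr a b = idm b;
  dprl_inr : forall a b, dprl a b ∘ dinr a b = 0;
  dprr_inl : forall a b, dprr a b ∘ dinl a b = 0;
  dsum_id : forall a b,
    dinl a b ∘ dprl a b + dinr a b ∘ dprr a b = idm (dsum a b)
}.
Arguments zero_ob {K} : rename.
Notation "a ⊕ b" := (dsum a b) : ttcat_scope.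

Record triangle (K : addCat) (T : functor K K) := Triangle {
  tri0 : K;
  tri1 : K;
  tri2 : K;
  mor0 : hom tri0 tri1;
  mor1 : hom tri1 tri2;
  mor2 : hom tri2 (T tri0)
}.
Arguments Triangle {K T tri0 tri1 tri2} mor0 mor1 mor2.

Definition is_tri_morphism (K : addCat) (T : functor K K) (s t : triangle T)
    (u : hom (tri0 s) (tri0 t)) (v : hom (tri1 s) (tri1 t))
    (w : hom (tri2 s) (tri2 t)) : Prop :=
  [/\ v ∘ mor0 s = mor0 t ∘ u,
      w ∘ mor1 s = mor1 t ∘ v &
      fmap T u ∘ mor2 s = mor2 t ∘ w].

(* Verdier's axioms TR1-TR4 for a class [D] of distinguished triangles. *)
Record triangulated (K : addCat) (T : functor K K) (D : triangle T -> Prop)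
    : Prop := Triangulated {
  tr1_iso : forall (s t : triangle T) u v w,
    @is_tri_morphism K T s t u v w -> is_iso u -> is_iso v -> is_iso w ->
    D s -> D t;
  tr1_id : forall a : K,
    D (Triangle (idm a) (0 : hom a zero_ob) (0 : hom zero_ob (T a)));
  tr1_cone : forall (a b : K) (f : hom a b),
    exists (c : K) (g : hom b c) (h : hom c (T a)), D (Triangle f g h);
  tr2 : forall (a b c : K) (f : hom a b) (g : hom b c) (h : hom c (T a)),
    D (Triangle f g h) <-> D (Triangle g h (- fmap T f));
  tr3 : forall (s t : triangle T) (u : hom (tri0 s) (tri0 t))
      (v : hom (tri1 s) (tri1 t)),
    D s -> D t -> v ∘ mor0 s = mor0 t ∘ u ->
    exists w : hom (tri2 s) (tri2 t), is_tri_morphism u v w;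
  tr4 : forall (a b c x y z : K) (f : hom a b) (g : hom b c)
      (f1 : hom b z) (f2 : hom z (T a))
      (g1 : hom c x) (g2 : hom x (T b))
      (h1 : hom c y) (h2 : hom y (T a)),
    D (Triangle f f1 f2) -> D (Triangle g g1 g2) ->
    D (Triangle (g ∘ f) h1 h2) ->
    exists (u : hom z y) (v : hom y x),
      [/\ D (Triangle u v (fmap T f1 ∘ g2)),
          u ∘ f1 = h1 ∘ g,
          h2 ∘ u = f2,
          v ∘ h1 = g1 &
          g2 ∘ v = fmap T f ∘ h2]
}.

Record triCat := TriCat {
  triCat_base :> addCat;
  shift : functor triCat_base triCat_base;
  shift_additive : additiveF shift;
  shift_equivalence : is_equivalence shift;
  distinguished : triangle shift -> Prop;
  distinguishedP : triangulated distinguished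
}.
Arguments shift {K} : rename.
Arguments distinguished {K} _ : rename.

(* The isomorphism [th : F T ~ T F] is part of what exactness asserts to
   exist: it turns the image of a triangle into a triangle. *)
Definition exactF (K L : triCat) (F : functor K L) : Prop :=
  additiveF F /\
  exists th : forall a : K, hom (F (shift a)) (shift (F a)),
    @is_nat_iso K L (compF F shift) (compF shift F) th /\
    forall (a b c : K) (f : hom a b) (g : hom b c) (h : hom c (shift a)),
      distinguished (Triangle f g h) ->
      distinguished (Triangle (fmap F f) (fmap F g) (th a ∘ fmap F h)).

Record symMonoidal (C : preaddCat) := SymMonoidal {
  unit_ob : C;
  tens : C -> C -> C;
  tensm : forall a a' b b', hom a a' -> hom b b' -> hom (tens a b) (tens a' b');
  tensm1 : forall a b, tensm (idm a) (idm b) = idm (tens a b);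
  tensmM : forall a a' a'' b b' b'' (f' : hom a' a'') (f : hom a a')
      (g' : hom b' b'') (g : hom b b'),
    tensm (f' ∘ f) (g' ∘ g) = tensm f' g' ∘ tensm f g;
  assoc : forall a b c, hom (tens (tens a b) c) (tens a (tens b c));
  lunit : forall a, hom (tens unit_ob a) a;
  runit : forall a, hom (tens a unit_ob) a;
  braid : forall a b, hom (tens a b) (tens b a);
  assoc_iso : forall a b c, is_iso (assoc a b c);
  lunit_iso : forall a, is_iso (lunit a);
  runit_iso : forall a, is_iso (runit a);
  assoc_nat : forall a a' b b' c c' (f : hom a a') (g : hom b b')
      (h : hom c c'),
    assoc a' b' c' ∘ tensm (tensm f g) h = tensm f (tensm g h) ∘ assoc a b c;
  lunit_nat : forall a a' (f : hom a a'),
    lunit a' ∘ tensm (idm unit_ob) f = f ∘ lunit a;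
  runit_nat : forall a a' (f : hom a a'),
    runit a' ∘ tensm f (idm unit_ob) = f ∘ runit a;
  braid_nat : forall a a' b b' (f : hom a a') (g : hom b b'),
    braid a' b' ∘ tensm f g = tensm g f ∘ braid a b;
  pentagon : forall a b c d,
    assoc a b (tens c d) ∘ assoc (tens a b) c d =
    tensm (idm a) (assoc b c d) ∘ assoc a (tens b c) d
      ∘ tensm (assoc a b c) (idm d);
  unit_triangle : forall a b,
    tensm (idm a) (lunit b) ∘ assoc a unit_ob b = tensm (runit a) (idm b);
  hexagon : forall a b c,
    assoc b c a ∘ braid a (tens b c) ∘ assoc a b c =
    tensm (idm b) (braid a c) ∘ assoc b a c ∘ tensm (braid a b) (idm c);
  braid_sym : forall a b, braid b a ∘ braid a b = idm (tens a b)
}.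

Program Definition tensL (C : preaddCat) (M : symMonoidal C) (a : C)
    : functor C C :=
  @Functor C C (tens M a) (fun _ _ f => tensm M (idm a) f) _ _.
Next Obligation. by move=> * /=; rewrite tensm1. Qed.
Next Obligation. by move=> * /=; rewrite -tensmM comp1m. Qed.

Program Definition tensR (C : preaddCat) (M : symMonoidal C) (b : C)
    : functor C C :=
  @Functor C C (fun a => tens M a b) (fun _ _ f => tensm M f (idm b)) _ _.
Next Obligation. by move=> * /=; rewrite tensm1. Qed.
Next Obligation. by move=> * /=; rewrite -tensmM comp1m. Qed.

Record ttCat := TTCat {
  ttCat_base :> triCat;
  ttCat_tensor : symMonoidal ttCat_base;
  tensL_exact : forall a : ttCat_base, @exactF ttCat_base ttCat_base (tensL ttCat_tensor a);
  tensR_exact : forall b : ttCat_base, @exactF ttCat_base ttCat_base (tensR ttCat_tensor b)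
}.
Notation "a ⊗ b" := (tens (ttCat_tensor _) a b) : ttcat_scope.

(* A full subcategory is given by its set of objects. *)
Record thick_tensor_ideal (K : ttCat) (A : set K) : Prop := ThickTensorIdeal {
  thick_zero : A zero_ob;
  thick_triangle : forall (a b c : K) (f : hom a b) (g : hom b c)
      (h : hom c (shift a)),
    distinguished (Triangle f g h) ->
    [/\ A a -> A b -> A c, A b -> A c -> A a & A a -> A c -> A b];
  thick_summand : forall a b c : K, A a -> isomorphic a (b ⊕ c) -> A b /\ A c;
  thick_tensor : forall a b : K, A a -> A (a ⊗ b)
}.

Record is_prime (K : ttCat) (P : set K) : Prop := IsPrime {
  prime_thick : thick_tensor_ideal P;
  prime_proper : P `<` [set: K];
  prime_tensor : forall a b : K, P (a ⊗ b) -> P a \/ P b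
}.

Record Spc (K : ttCat) := Prime {
  prime_set : set K;
  prime_setP : is_prime prime_set
}.

Definition Z (K : ttCat) (S : set K) : set (Spc K) :=
  [set P : Spc K | S `&` prime_set P = set0].

Definition supp (K : ttCat) (a : K) : set (Spc K) := Z [set a].

Definition U (K : ttCat) (a : K) : set (Spc K) := ~` supp a.

Lemma suppE (K : ttCat) (a : K) : supp a = [set P : Spc K | ~ prime_set P a].
Proof.
apply/seteqP; split=> P /=.
  by move=> E Pa; have : ([set a] `&` prime_set P) a by []; rewrite E.
by move=> nPa; apply/seteqP; split=> // x [/= ->].
Qed.

Lemma UE (K : ttCat) (a : K) : U a = [set P : Spc K | prime_set P a].
Proof. by rewrite /U suppE; apply/seteqP; split=> P /= => [/contrapT|? []]. Qed.

Section Additivity.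
Variable C : preaddCat.
Implicit Types a b c : C.

Lemma comp0m a b c (f : hom a b) : (0 : hom b c) ∘ f = 0.
Proof. by apply: (addIr (0 ∘ f)); rewrite -compDl !add0r. Qed.

Lemma compm0 a b c (g : hom b c) : g ∘ (0 : hom a b) = 0.
Proof. by apply: (addIr (g ∘ 0)); rewrite -compDr !add0r. Qed.

Lemma compNm a b c (g : hom b c) (f : hom a b) : (- g) ∘ f = - (g ∘ f).
Proof. by apply: (addIr (g ∘ f)); rewrite -compDl !addNr comp0m. Qed.

Lemma compBm a b c (g g' : hom b c) (f : hom a b) :
  (g - g') ∘ f = g ∘ f - g' ∘ f.
Proof. by rewrite compDl compNm. Qed.

Lemma is_iso_id a : is_iso (idm a).
Proof. by exists (idm a); rewrite comp1m. Qed.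

End Additivity.

Section DirectSums.
Variable K : triCat.
Implicit Types a b c x : K.

Lemma hom0_from (x : K) (f : hom (@zero_ob K) x) : f = 0.
Proof. by rewrite -[f]compm1 zero_obP compm0. Qed.

Lemma shift0 (a b : K) : fmap shift (0 : hom a b) = 0.
Proof.
by apply: (addIr (fmap shift 0)); rewrite -(@shift_additive K) !add0r.
Qed.

Lemma hom0_from_shift (x : K) (f : hom (shift (@zero_ob K)) x) : f = 0.
Proof. by rewrite -[f]compm1 -fmap1 zero_obP shift0 compm0. Qed.

Lemma distinguished_0id (x : K) :
  distinguished (Triangle (0 : hom (@zero_ob K) x) (idm x) 0).
Proof.
have [tI tid _ t2 _ _] := distinguishedP K.
apply/t2; rewrite shift0 oppr0.
pose s := @Triangle K shift _ _ _ (idm x) (0 : hom x (@zero_ob K)) 0.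
pose t := @Triangle K shift _ _ _ (idm x) (0 : hom x (shift (@zero_ob K))) 0.
apply: (tI s t (idm x) (idm x) 0) => //=.
- by split; rewrite /= ?comp1m ?comp0m ?compm0 ?compm1.
- exact: is_iso_id.
- exact: is_iso_id.
- exists 0; split; first by rewrite comp0m zero_obP.
  by rewrite comp0m -fmap1 zero_obP shift0.
- exact: tid.
Qed.

Lemma weak_cokernel a b c x (f : hom a b) (g : hom b c) (h : hom c (shift a))
    (u : hom b x) :
  distinguished (Triangle f g h) -> u ∘ f = 0 ->
  exists v : hom c x, v ∘ g = u.
Proof.
move=> d uf0; have [_ _ _ _ t3 _] := distinguishedP K.
have [|w [_ /= wE _]] := t3 (Triangle f g h)
    (Triangle (0 : hom (@zero_ob K) x) (idm x) 0) 0 u d (distinguished_0id x).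
  by rewrite /= uf0 comp0m.
by exists w; rewrite wE comp1m.
Qed.

Lemma distinguished_comp0 a b c (f : hom a b) (g : hom b c)
    (h : hom c (shift a)) :
  distinguished (Triangle f g h) -> g ∘ f = 0.
Proof.
move=> d; have [_ tid _ _ t3 _] := distinguishedP K.
have [|w [_ /= wE _]] := t3 (Triangle (idm a) 0 0) (Triangle f g h)
  (idm a) f (tid a) d; first by [].
by rewrite -wE compm0.
Qed.

Lemma distinguished_split a b : exists h : hom b (shift a),
  distinguished (Triangle (dinl a b) (dprr a b) h).
Proof.
have [tI _ tc t2 _ _] := distinguishedP K.
have [c [g [h d]]] := tc _ _ (dinl a b).
have d1 := (t2 _ _ _ _ _ _).1 d; have d2 := (t2 _ _ _ _ _ _).1 d1.
have h0 : h = 0.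
  have /eqP := distinguished_comp0 d2; rewrite compNm oppr_eq0 => /eqP E.
  by rewrite -[h]comp1m -fmap1 -(dprl_inl a b) fmapM -compA E compm0.
have [p pg] := weak_cokernel d (dprr_inl a b).
pose q := g ∘ dinr a b.
have pq : p ∘ q = idm b by rewrite /q compA pg dprr_inr.
have qpg : q ∘ p ∘ g = g.
  rewrite -compA pg /q -compA; have := compm1 g; rewrite -dsum_id compDr.
  by rewrite compA (distinguished_comp0 d) comp0m add0r.
have qp : q ∘ p = idm c.
  apply/eqP; rewrite -subr_eq0; apply/eqP.
  have [|k <-] := @weak_cokernel _ _ _ _ _ _ _ (q ∘ p - idm c) d1.
    by rewrite compBm qpg comp1m subrr.
  by rewrite h0 compm0.
exists 0; apply: (tI (Triangle (dinl a b) g h) (Triangle (dinl a b) (dprr a b) 0)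
  (idm a) (idm (a ⊕ b)) p _ _ _ _ d) => /=.
- by split; rewrite /= ?h0 ?comp1m ?compm1 ?compm0 ?comp0m.
- exact: is_iso_id.
- exact: is_iso_id.
- by exists q.
Qed.

End DirectSums.

Lemma thick_dsum (K : ttCat) (A : set K) (a b : K) :
  thick_tensor_ideal A -> A (a ⊕ b) <-> A a /\ A b.
Proof.
move=> tA; split=> [Aab|[Aa Ab]].
  by apply: (thick_summand tA Aab); exists (idm _); exact: is_iso_id.
have [h d] := distinguished_split a b.
by have [_ _] := thick_triangle tA d; apply.
Qed.

Lemma ZE (K : ttCat) (S : set K) :
  Z S = [set P : Spc K | forall a, S a -> ~ prime_set P a].
Proof.
apply/seteqP; split=> P /= => [E a Sa Pa|SP].
  by have : (S `&` prime_set P) a by []; rewrite E.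
by apply/seteqP; split=> // a [/SP].
Qed.

Section Zariski.
Variable K : ttCat.

Definition Zariski_open (O : set (Spc K)) : Prop :=
  exists S : set K, ~` O = Z S.

Lemma Zariski_openT : Zariski_open setT.
Proof.
exists setT; rewrite setCT ZE; apply/seteqP; split=> // P /= /(_ zero_ob I).
by case; apply: thick_zero (prime_thick (prime_setP P)).
Qed.

Lemma Zariski_openI : setI_closed Zariski_open.
Proof.
move=> O O' [S OS] [S' OS'].
exists [set c | exists a b, [/\ S a, S' b & c = a ⊕ b]].
rewrite setCI OS OS' !ZE; apply/seteqP; split=> P /=.
  move=> H _ [a [b [Sa S'b ->]]].
  move/(thick_dsum _ _ (prime_thick (prime_setP P))) => [Pa Pb].
  by case: H => [/(_ a Sa)|/(_ b S'b)].
move=> H; apply: contrapT => /not_orP[/existsNP[a /not_implyP[Sa /contrapT Pa]]].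
move=> /existsNP[b /not_implyP[S'b /contrapT Pb]].
apply: (H (a ⊕ b)); first by exists a, b.
by apply/(thick_dsum _ _ (prime_thick (prime_setP P))).
Qed.

Lemma Zariski_open_bigU (I : Type) (f : I -> set (Spc K)) :
  (forall i, Zariski_open (f i)) -> Zariski_open (\bigcup_i f i).
Proof.
move=> /choice[S fS]; exists (\bigcup_i S i); rewrite setC_bigcup.
rewrite (eq_bigcapr (fun i _ => fS i)) ZE; apply/seteqP; split=> P /=.
  by move=> H a [i _ Sa]; have := H i Logic.I; rewrite ZE /=; exact.
by move=> H i _; rewrite ZE => a Sa; apply: H; exists i.
Qed.

HB.instance Definition _ := gen_eqMixin (Spc K).
HB.instance Definition _ := gen_choiceMixin (Spc K).
HB.instance Definition _ := @isOpenTopological.Build (Spc K)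
  Zariski_open Zariski_openT Zariski_openI Zariski_open_bigU.

Lemma Zariski_openE : @open (Spc K) = Zariski_open.
Proof. by []. Qed.

Lemma Zariski_closedP (A : set (Spc K)) :
  closed A <-> exists S : set K, A = Z S.
Proof.
by rewrite -openC Zariski_openE /Zariski_open setCK.
Qed.

End Zariski.

(* Main.v *)
Require Import Defs.
From mathcomp Require Import all_boot all_order all_algebra.
From mathcomp Require Import boolp classical_sets topology.
From mathcomp Require Import finmap.
Import Defs.

(** Primes behave here as in a commutative ring, with [⊗] in the role of the
    product and [⊕] in that of the sum.  An ideal disjoint from a family of
    objects that contains the unit and is closed under [⊗] extends, by Zorn, to
    a maximal one, and the maximal one is prime ([prime_separation]).

    For (a), fix an open cover of [U a] and consider the family [M] of all [x]
    such that finitely many members of the cover contain [U x].  As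
    [U (x ⊗ y) = U x `|` U y], [M] contains the unit and is closed under [⊗].
    A prime containing [a] and avoiding [M] would be a point of [U a], hence lie
    in some member of the cover, hence in some basic open [U s] inside this
    member; then [s] is in [M] and in the prime, which is absurd.  So [M] meets
    every ideal containing [a], in particular the smallest one: there is [x] in
    [M] that lies in every prime containing [a].  Hence [U a `<=` U x], and
    finitely many members of the cover suffice.

    For (b), an open set is a union of sets [U s] ([open_basic]); if it is
    quasi-compact, finitely many [s] are enough, and their tensor product is the
    required object ([bigcup_U]). *)

Set Implicit Arguments.
Unset Strict Implicit.
Unset Printing Implicit Defensive.

Local Open Scope classical_set_scope.
Local Open Scope ttcat_scope.

(** * Thick tensor ideals *)

Lemma is_iso_fmap (C D : preaddCat) (F : functor C D) (a b : C)
    (f : hom a b) : is_iso f -> is_iso (fmap F f).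
Proof.
by move=> [g [gf fg]]; exists (fmap F g); rewrite -!fmapM gf fg !fmap1.
Qed.

Lemma isomorphic_fob (C D : preaddCat) (F : functor C D) (a b : C) :
  isomorphic a b -> isomorphic (F a) (F b).
Proof. by move=> [f /(is_iso_fmap F) ?]; exists (fmap F f). Qed.

Lemma isomorphic_sym (C : preaddCat) (a b : C) :
  isomorphic a b -> isomorphic b a.
Proof. by move=> [f [g [gf fg]]]; exists g, f. Qed.

Lemma isomorphic_trans (C : preaddCat) (b a c : C) :
  isomorphic a b -> isomorphic b c -> isomorphic a c.
Proof.
move=> [f [f' [f'f ff']]] [g [g' [g'g gg']]]; exists (g ∘ f), (f' ∘ g'); split.
  by rewrite compA -(compA f') g'g compm1.
by rewrite compA -(compA g) ff' compm1.
Qed.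

Lemma isomorphic_dsum0 (K : addCat) (a : K) : isomorphic a (a ⊕ zero_ob).
Proof.
exists (dinl a zero_ob), (dprl a zero_ob); split; first exact: dprl_inl.
rewrite -dsum_id -[dprr a zero_ob]comp1m zero_obP comp0m compm0.
by rewrite GRing.addr0.
Qed.

Lemma isomorphic_additive_dsum (K : addCat) (F : functor K K) (a b : K) :
  additiveF F -> isomorphic (F (a ⊕ b)) (F a ⊕ F b).
Proof.
move=> addF.
have F0 (x y : K) : fmap F (0%R : hom x y) = 0%R.
  by apply: (GRing.addIr (fmap F 0%R)); rewrite -addF !GRing.add0r.
exists (dinl (F a) (F b) ∘ fmap F (dprl a b)
        + dinr (F a) (F b) ∘ fmap F (dprr a b))%R.
exists (fmap F (dinl a b) ∘ dprl (F a) (F b)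
        + fmap F (dinr a b) ∘ dprr (F a) (F b))%R.
split.
  rewrite !compDr !compDl !compA.
  rewrite -!(compA _ (dprl _ _) (dinl _ _)) -!(compA _ (dprr _ _) (dinl _ _)).
  rewrite -!(compA _ (dprl _ _) (dinr _ _)) -!(compA _ (dprr _ _) (dinr _ _)).
  rewrite dprl_inl dprr_inl dprl_inr dprr_inr !compm0 !comp0m !compm1.
  by rewrite GRing.addr0 GRing.add0r -!fmapM -addF dsum_id fmap1.
rewrite !compDr !compDl !compA.
rewrite -!(compA _ (fmap F (dprl _ _)) (fmap F (dinl _ _))).
rewrite -!(compA _ (fmap F (dprr _ _)) (fmap F (dinl _ _))).
rewrite -!(compA _ (fmap F (dprl _ _)) (fmap F (dinr _ _))).
rewrite -!(compA _ (fmap F (dprr _ _)) (fmap F (dinr _ _))).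
rewrite -!fmapM dprl_inl dprr_inl dprl_inr dprr_inr !F0 !fmap1.
by rewrite !compm0 !comp0m !compm1 GRing.addr0 GRing.add0r dsum_id.
Qed.

Section Ideals.
Variable K : ttCat.
Implicit Types (a b c x y : K) (A J M : set K).

Local Notation "1" := (unit_ob (ttCat_tensor K)).

Lemma isomorphic_braid a b : isomorphic (a ⊗ b) (b ⊗ a).
Proof. by exists (braid _ a b), (braid _ b a); rewrite !braid_sym. Qed.

Lemma isomorphic_assoc a b c : isomorphic ((a ⊗ b) ⊗ c) (a ⊗ (b ⊗ c)).
Proof. by exists (assoc _ a b c); apply: assoc_iso. Qed.

Lemma isomorphic_unit a : isomorphic (1 ⊗ a) a.
Proof. by exists (lunit _ a); apply: lunit_iso. Qed.

(** An isomorphism [a ≃ b] presents [b] as a summand of [a], the complement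
    being [0]. *)
Lemma thick_iso A a b :
  thick_tensor_ideal A -> isomorphic a b -> A a -> A b.
Proof.
move=> tA ab Aa; have [] // := @thick_summand _ _ tA a b zero_ob Aa.
exact: isomorphic_trans ab (isomorphic_dsum0 b).
Qed.

Lemma thick_tensorl A a b : thick_tensor_ideal A -> A b -> A (a ⊗ b).
Proof.
by move=> tA Ab; apply: (thick_iso tA (isomorphic_braid b a)); apply: thick_tensor.
Qed.

Lemma thick_unit A : thick_tensor_ideal A -> A 1 -> A = setT.
Proof.
move=> tA A1; apply/seteqP; split=> // x _.
by apply: (thick_iso tA (isomorphic_unit x)); apply: thick_tensor.
Qed.

(** The ideal quotient [A : a]: exactness of [a ⊗ -] lets it inherit from [A]
    the stability under triangles and under summands. *)
Lemma thick_quotient A a :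
  thick_tensor_ideal A -> thick_tensor_ideal [set x | A (a ⊗ x)].
Proof.
move=> tA; have [addL [th [_ triL]]] := tensL_exact a.
split=> /=.
- exact: thick_tensorl tA (thick_zero tA).
- by move=> x y z f g h /triL /(thick_triangle tA).
- move=> x y z Aax xyz; apply/(thick_dsum _ _ tA).
  apply: (thick_iso tA _ Aax).
  apply: (isomorphic_trans _ (isomorphic_additive_dsum y z addL)).
  exact: (isomorphic_fob (tensL (ttCat_tensor K) a)).
- move=> x y Aax; apply: (thick_iso tA (isomorphic_assoc a x y)).
  exact: thick_tensor.
Qed.

Lemma thick_bigcap (F : set (set K)) :
  (forall A, F A -> thick_tensor_ideal A) ->
  thick_tensor_ideal (\bigcap_(A in F) A).
Proof.
move=> tF; split.
- by move=> A FA; apply: thick_zero (tF _ FA).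
- move=> a b c f g h d; split=> H H' A FA;
    have [d1 d2 d3] := thick_triangle (tF _ FA) d.
  + exact: d1 (H _ FA) (H' _ FA).
  + exact: d2 (H _ FA) (H' _ FA).
  + exact: d3 (H _ FA) (H' _ FA).
- move=> a b c H abc; split=> A FA.
  + exact: (thick_summand (tF _ FA) (H _ FA) abc).1.
  + exact: (thick_summand (tF _ FA) (H _ FA) abc).2.
- by move=> a b H A FA; apply: (thick_tensor (tF _ FA)); apply: H.
Qed.

Lemma thick_bigcup_chain (F : set (set K)) :
  F !=set0 -> total_on F subset ->
  (forall A, F A -> thick_tensor_ideal A) ->
  thick_tensor_ideal (\bigcup_(A in F) A).
Proof.
move=> [A0 FA0] totF tF.
have common x y : (\bigcup_(A in F) A) x -> (\bigcup_(A in F) A) y ->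
    exists A, [/\ F A, A x & A y].
  move=> [A FA Ax] [B FB By]; case: (totF _ _ FA FB) => [AB|BA].
    by exists B; split=> //; apply: AB.
  by exists A; split=> //; apply: BA.
split.
- by exists A0 => //; apply: thick_zero (tF _ FA0).
- move=> a b c f g h d; split=> H H'; have [A [FA Ax Ay]] := common _ _ H H';
    have [d1 d2 d3] := thick_triangle (tF _ FA) d; exists A => //.
  + exact: d1.
  + exact: d2.
  + exact: d3.
- move=> a b c [A FA Aa] abc.
  by have [Ab Ac] := thick_summand (tF _ FA) Aa abc; split; exists A.
- by move=> a b [A FA Aa]; exists A => //; apply: (thick_tensor (tF _ FA)).
Qed.

Definition ideal_gen A : set K :=
  \bigcap_(J in [set J | thick_tensor_ideal J /\ A `<=` J]) J.

Lemma ideal_gen_thick A : thick_tensor_ideal (ideal_gen A).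
Proof. by apply: thick_bigcap => J []. Qed.

Lemma sub_ideal_gen A : A `<=` ideal_gen A.
Proof. by move=> x Ax J [_]; apply. Qed.

Lemma ideal_gen_sub A J : thick_tensor_ideal J -> A `<=` J -> ideal_gen A `<=` J.
Proof. by move=> tJ AJ x; apply. Qed.

(** The inclusion [<A, a> ⊗ <A, b> `<=` <A, a ⊗ b> = A], read off from two ideal
    quotients, so that no description of generated ideals is used. *)
Lemma ideal_gen_tensor A a b x y : thick_tensor_ideal A -> A (a ⊗ b) ->
  ideal_gen (A `|` [set a]) x -> ideal_gen (A `|` [set b]) y -> A (x ⊗ y).
Proof.
move=> tA Aab xa yb.
have Aay : A (a ⊗ y).
  apply: (ideal_gen_sub (thick_quotient a tA) _ yb) => z [Az|->] //=.
  exact: thick_tensorl.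
apply: (thick_iso tA (isomorphic_braid y x)).
apply: (ideal_gen_sub (thick_quotient y tA) _ xa) => z [Az|->] /=.
  exact: thick_tensorl.
exact: thick_iso tA (isomorphic_braid a y) Aay.
Qed.

(** * Existence of primes *)

Lemma maximal_disjoint_ideal J M :
  thick_tensor_ideal J -> J `&` M = set0 ->
  exists A, [/\ thick_tensor_ideal A, J `<=` A, A `&` M = set0 &
    forall B, thick_tensor_ideal B -> A `<` B -> B `&` M !=set0].
Proof.
move=> tJ JM.
(* Zorn is applied to the [X] such that [X `|` J] is an ideal avoiding [M]
   rather than to ideals containing [J]: the empty chain, whose union is empty,
   then satisfies the requirement. *)
pose good (X : set K) :=
  thick_tensor_ideal (X `|` J) /\ (X `|` J) `&` M = set0.
have [|X [[tX XM] maxX]] := @Zorn_bigcup K good.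
  move=> F goodF totF.
  pose G := [set A | A = J \/ exists2 X, F X & A = X `|` J].
  have -> : good (\bigcup_(X in F) X) =
      (thick_tensor_ideal (\bigcup_(A in G) A) /\
       (\bigcup_(A in G) A) `&` M = set0).
    rewrite /good; suff -> : \bigcup_(X in F) X `|` J = \bigcup_(A in G) A by [].
    apply/seteqP; split=> x.
      move=> [[X FX Xx]|Jx]; last by exists J => //; left.
      by exists (X `|` J); [right; exists X | left].
    move=> [A [->|[X FX ->]]]; first by right.
    by move=> [Xx|Jx]; [left; exists X | right].
  have goodG A : G A -> thick_tensor_ideal A /\ A `&` M = set0.
    by move=> [->|[X FX ->]] //; exact: goodF.
  split.
    apply: thick_bigcup_chain; first by exists J; left.
    - move=> A B [->|[X FX ->]] [->|[Y FY ->]].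
      + by left.
      + by left=> x; right.
      + by right=> x; right.
      + by case: (totF _ _ FX FY) => XY; [left|right]; apply: setSU.
    - by move=> A /goodG[].
  by rewrite setI_bigcupl; apply: bigcup0 => A /goodG[].
exists (X `|` J); split=> // B tB [XB BX].
apply: contrapT => /nonemptyPn BM.
have JB : J `<=` B by move=> x Jx; apply: XB; right.
apply: (maxX B); last by rewrite /good (setUidl JB).
split=> [x Xx|BsubX]; first by apply: XB; left.
by apply: BX => x /BsubX; left.
Qed.

(** The analogue of Krull's theorem.  If [a] and [b] are outside the maximal
    [A], then [M] contains some [x] in [<A, a>] and some [y] in [<A, b>], hence
    [x ⊗ y]; this object would be in [A] if [a ⊗ b] were. *)
Lemma prime_separation J M :
  thick_tensor_ideal J -> J `&` M = set0 ->
  M 1 -> (forall x y, M x -> M y -> M (x ⊗ y)) ->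
  exists P : Spc K, J `<=` prime_set P /\ prime_set P `&` M = set0.
Proof.
move=> tJ JM M1 MM; have [A [tA JA AM maxA]] := maximal_disjoint_ideal tJ JM.
have meets a : ~ A a -> exists2 x, ideal_gen (A `|` [set a]) x & M x.
  move=> nAa; have [|x []] := maxA _ (ideal_gen_thick (A `|` [set a])).
    split=> [x Ax|sub]; first by apply: sub_ideal_gen; left.
    by apply: nAa; apply: sub; apply: sub_ideal_gen; right.
  by exists x.
have AMF x : A x -> M x -> False.
  by move=> Ax Mx; have : (A `&` M) x by []; rewrite AM.
suff pA : is_prime A by exists (Prime pA).
split=> // [|a b Aab].
  by split=> // TA; apply: AMF M1; apply: TA.
apply: contrapT => /not_orP[/meets[x xa Mx] /meets[y yb My]].
exact: AMF (ideal_gen_tensor tA Aab xa yb) (MM _ _ Mx My).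
Qed.

(** * The basic open sets *)

Lemma open_U a : open (U a).
Proof. by rewrite Zariski_openE; exists [set a]; rewrite setCK. Qed.

Lemma U_unit : U 1 = set0.
Proof.
rewrite UE; apply/seteqP; split=> // P /= P1.
have [_] := prime_proper (prime_setP P); apply.
by rewrite (thick_unit (prime_thick (prime_setP P)) P1).
Qed.

Lemma U_tensor a b : U (a ⊗ b) = U a `|` U b.
Proof.
rewrite !UE; apply/seteqP; split=> P /=; first exact: (prime_tensor (prime_setP P)).
have tP := prime_thick (prime_setP P).
by case=> [Pa|Pb]; [apply: thick_tensor | apply: thick_tensorl].
Qed.

Lemma bigcup_U (s : seq {classic K}) :
  exists a : K, U a = \bigcup_(x in [set` s]) U (x : K).
Proof.
elim: s => [|x s [a Ua]].
  by exists 1; rewrite U_unit; apply/esym/bigcup0.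
exists ((x : K) ⊗ a); rewrite U_tensor Ua; apply/seteqP; split=> P.
  case=> [xP|[y ys yP]]; first by exists x => //=; rewrite mem_head.
  by exists y => //=; rewrite in_cons; apply/orP; right.
move=> [y /=]; rewrite in_cons => /orP[/eqP ->|ys]; first by left.
by right; exists y.
Qed.

Lemma open_basic (O : set (Spc K)) (P : Spc K) :
  open O -> O P -> exists s : K, U s P /\ U s `<=` O.
Proof.
rewrite Zariski_openE => -[S OS] OP.
have : ~ Z S P by rewrite -OS.
rewrite ZE => /existsNP[s /not_implyP[Ss /contrapT Ps]].
exists s; rewrite UE; split=> // Q /= Qs; apply: contrapT => nOQ.
have : Z S Q by rewrite -OS.
by rewrite ZE => /(_ s Ss).
Qed.

End Ideals.

(** * Quasi-compactness *)

Lemma finite_subset_coverU (I : choiceType) (T : Type) (D : set I)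
    (f : I -> set T) (A B : set T) :
  finite_subset_cover D f A -> finite_subset_cover D f B ->
  finite_subset_cover D f (A `|` B).
Proof.
move=> [DA DAD AD] [DB DBD BD]; exists (DA `|` DB)%fset.
  by move=> i; rewrite in_fsetU => /orP[/DAD|/DBD].
rewrite set_fsetU /cover bigcup_setU; exact: setUSS.
Qed.

Lemma cover_compact_U (K : ttCat) (a : K) : cover_compact (U a).
Proof.
move=> I D f fo Uaf.
pose M := [set x : K | finite_subset_cover D f (U x)].
suff [x xa [D' D'D Ux]] : exists2 x, ideal_gen [set a] x & M x.
  exists D' => //; apply: subset_trans Ux; rewrite !UE => P /= Pa.
  by apply: (ideal_gen_sub (prime_thick (prime_setP P)) _ xa) => _ ->.
apply: contrapT => aM.
have [|||P [aP PM]] := @prime_separation K (ideal_gen [set a]) M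
    (ideal_gen_thick _).
- by apply/seteqP; split=> // x [xa Mx]; apply: aM; exists x.
- by rewrite /M /= U_unit; exists fset0 => // ?.
- by move=> x y Mx My; rewrite /M /= U_tensor; apply: finite_subset_coverU.
have UaP : U a P by rewrite UE; apply: aP; apply: sub_ideal_gen.
have [i Di fiP] := Uaf _ UaP; have [s [UsP Usf]] := open_basic (fo i Di) fiP.
suff : (prime_set P `&` M) s by rewrite PM.
split; first by move: UsP; rewrite UE.
exists [fset i]%fset; first by move=> j; rewrite inE => /eqP ->; rewrite in_setE.
by rewrite set_fset1 /cover bigcup_set1.
Qed.

Lemma cover_compact_openE (K : ttCat) (O : set (Spc K)) :
  open O -> cover_compact O -> exists a : K, O = U a.
Proof.
move=> oO cO.
have [|P OP|D' D'D OD'] := cO {classic K} [set s | U (s : K) `<=` O]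
    (fun s => U (s : K)).
- by move=> s _; apply: open_U.
- by have [s [UsP UsO]] := open_basic oO OP; exists s.
have [a Ua] := bigcup_U (D' : seq {classic K}); exists a; rewrite Ua.
apply/seteqP; split=> // P [s /D'D]; rewrite in_setE; exact.
Qed.

Theorem proposition2p14 (K : ttCat) :
  (forall a : K, open (U a) /\ cover_compact (U a)) /\
  (forall O : set (Spc K), open O -> cover_compact O ->
     exists a : K, O = U a).
Proof.
split; last exact: cover_compact_openE.
by move=> a; split; [exact: open_U | exact: cover_compact_U].
Qed.
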